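(* Let $d=1$ and let $(X_1,M_1),\dots,(X_n,M_n)$ be i.i.d. copies of $(X,M)\sim\mathbb{P}_{X,M}$, $X\in\mathbb{R}$, $M\in\{0,1\}$ ($M=0$: $X$ observed), with arbitrary missingness mechanism $\pi(x)=\mathbb{P}[M=0\mid X=x]$. Assume $\mathbb{P}_X=(1-\epsilon)P_{\theta^*}+\epsilon\mathbb{Q}_X$ for some $\theta^*\in\Theta$, some distribution $\mathbb{Q}_X$ on $\mathbb{R}$ and $\epsilon\in[0,1)$, and let $\pi^*=\mathbb{E}_{X\sim P_{\theta^*}}[\pi(X)]>0$. Let $\theta_n^{\mathrm{MMD}}$ be a minimizer over $\Theta$ of $\theta\mapsto\frac1n\sum_{i:M_i=0}\mathbb{D}^2(P_\theta,\delta_{\{X_i\}})$ (equivalently of $\mathbb{D}(P_\theta,P_n)$, $P_n$ the empirical measure of the observed $X_i$). Then $$ \mathbb{E}_{\mathcal{S}}\big[\mathbb{D}(P_{\theta_n^{\mathrm{MMD}}},P_{\theta^*})\big]\le 4\epsilon+\frac{8\epsilon}{\pi^*(1-\epsilon)}+\frac{2\sqrt{\mathbb{V}_{X\sim P_{\theta^*}}[\pi(X)]}}{\pi^*}+\frac{2\sqrt2}{\sqrt{n\pi^*(1-\epsilon)}}, $$ where $\mathbb{E}_{\mathcal{S}}$ is the expectation over the sample $\{(X_i,M_i)\}_{1\le i\le n}$.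
   Context: $\{P_\theta:\theta\in\Theta\}$ is a model on $\mathbb{R}$. $k$ is a positive definite kernel on $\mathbb{R}$ bounded by $1$ and characteristic, with RKHS $\mathcal{H}$, mean embedding $\Phi(Q)=\mathbb{E}_{Y\sim Q}[k(Y,\cdot)]$ and MMD $\mathbb{D}(Q_1,Q_2)=\|\Phi(Q_1)-\Phi(Q_2)\|_{\mathcal{H}}$. *)

(* Defs.v *)
From HB Require Import structures.
From mathcomp Require Import all_boot all_order all_algebra.
From mathcomp Require Import all_classical all_reals all_analysis.
Set Implicit Arguments. Unset Strict Implicit. Unset Printing Implicit Defensive.
Import Order.TTheory GRing.Theory Num.Theory.
Import numFieldNormedType.Exports.
Local Open Scope classical_set_scope.
Local Open Scope ring_scope.

Definition pd_kernel {R : realType} (k : R -> R -> R) : Prop :=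
  (forall x y, k x y = k y x) /\
  (forall (m : nat) (c : 'I_m -> R) (x : 'I_m -> R),
      0 <= \sum_(i < m) \sum_(j < m) c i * c j * k (x i) (x j)).

Definition kernel_bounded_by_1 {R : realType} (k : R -> R -> R) : Prop :=
  forall x y, `|k x y| <= 1.

(* E_{Y~mu, Y'~nu} k(Y,Y') = <Phi(mu), Phi(nu)>_H  (reproducing property). *)
Definition kint {R : realType} (k : R -> R -> R)
  (mu nu : {measure set R -> \bar R}) : R :=
  fine (\int[mu]_x \int[nu]_y (k x y)%:E)%E.

(* Squared MMD: || Phi(mu) - Phi(nu) ||_H^2 expanded. *)
Definition MMD2 {R : realType} (k : R -> R -> R)
  (mu nu : {measure set R -> \bar R}) : R :=
  kint k mu mu - 2 * kint k mu nu + kint k nu nu.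

Definition MMD {R : realType} (k : R -> R -> R)
  (mu nu : {measure set R -> \bar R}) : R := Num.sqrt (MMD2 k mu nu).

(* Characteristic kernel: the mean embedding is injective on probability
   measures, i.e. D(P,Q) = 0 implies P = Q. *)
Definition characteristic {R : realType} (k : R -> R -> R) : Prop :=
  forall P Q : probability R R, MMD k P Q = 0 ->
    forall A, measurable A -> P A = Q A.

(* Expectation over an i.i.d. sample of size n of pairs (X_i, M_i), where
   X ~ PX and P[M = 0 | X = x] = pi x.  M is encoded as a bool:
   false = 0 (X observed), true = 1 (X missing).  The expectation is the
   iterated integral against the n-fold product law (Tonelli), for
   nonnegative g. *)
Fixpoint sample_expect {R : realType} (PX : probability R R) (pi : R -> R)
  (n : nat) (g : seq (R * bool) -> \bar R) : \bar R :=
  match n with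
  | 0 => g [::]
  | n'.+1 =>
      (\int[PX]_x
         ((pi x)%:E * sample_expect PX pi n' (fun s => g ((x, false) :: s))
          + (1 - pi x)%:E * sample_expect PX pi n' (fun s => g ((x, true) :: s))))%E
  end.

Definition mmd_criterion {R : realType} {Theta : Type}
  (k : R -> R -> R) (P : Theta -> probability R R) (n : nat)
  (s : seq (R * bool)) (theta : Theta) : R :=
  n%:R^-1 * \sum_(p <- s | ~~ p.2) MMD2 k (P theta) (\d_(p.1) : {measure set R -> \bar R}).

(* Main.v *)
(* The kernel defines the positive semidefinite form
   [B mu nu = int int k(x,y) dmu(x) dnu(y)] on finite signed measures, and the MMD is
   the induced seminorm of a difference.  With S the sum of the Dirac masses at the N
   observed points, minimising the criterion amounts to minimising [|N P_theta - S|],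
   so for N > 0 the triangle inequality gives
   [D(P_theta_n, P_star) <= 2 |S - N P_obs| / N + 2 |P_obs - P_star|], where P_obs is
   the law of X given M = 0; for N = 0 one only uses [D <= 2].
   Bias: expanding the contamination,
   [P_obs - P_star = (pi - pi_star) P_star / pi_star - (eps q / (p pi_star)) pi P_star
   + (eps / p) pi Q] with [p = E_PX pi] and [q = E_Q pi], and [|f mu| <= int |f| dmu].
   Fluctuation: [E |S - N P_obs|^2 phi(N) <= E N phi(N)] with N binomial(n, p), and
   [E 1/(N+1) <= 1/((n+1) p)]; AM-GM replaces Jensen.
   No measurability of theta_n is available: the integrand is bounded pointwise by a
   measurable one, and the integral of nonnegative functions is monotone regardless. *)
Require Import Defs.
From HB Require Import structures.
From mathcomp Require Import all_boot all_order all_algebra.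
From mathcomp Require Import all_classical all_reals all_analysis measurable_realfun.
From mathcomp Require Import ring lra.
Set Implicit Arguments. Unset Strict Implicit. Unset Printing Implicit Defensive.
Import Order.TTheory GRing.Theory Num.Theory.
Import numFieldNormedType.Exports.
Local Open Scope classical_set_scope.
Local Open Scope ring_scope.

(** * Bounded measurable functions and their integrals against probability measures *)

Definition bmeas d (T : measurableType d) (R : realType) (f : T -> R) : Prop :=
  measurable_fun setT f /\ exists M, forall x, `|f x| <= M.
Arguments bmeas {d T R} f.

Section BoundedMeasurable.
Context d (T : measurableType d) (R : realType).
Implicit Types (f g : T -> R) (mu : probability T R).

Lemma bmeas_cst (c : R) : bmeas (fun _ : T => c).
Proof. by split; [exact: measurable_cst | exists `|c|]. Qed.

Lemma bmeasD f g : bmeas f -> bmeas g -> bmeas (fun x => f x + g x).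
Proof.
move=> [mf [M fM]] [mg [N gN]]; split; first exact: measurable_funD.
by exists (M + N) => x; rewrite (le_trans (ler_normD _ _))// lerD.
Qed.

Lemma bmeasM f g : bmeas f -> bmeas g -> bmeas (fun x => f x * g x).
Proof.
move=> [mf [M fM]] [mg [N gN]]; split; first exact: measurable_funM.
by exists (M * N) => x; rewrite normrM ler_pM.
Qed.

Lemma bmeasZ c f : bmeas f -> bmeas (fun x => c * f x).
Proof. by move=> bf; apply: bmeasM => //; exact: bmeas_cst. Qed.

Lemma bmeasN f : bmeas f -> bmeas (fun x => - f x).
Proof.
move=> [mf [M fM]]; split; first exact: measurableT_comp.
by exists M => x; rewrite normrN.
Qed.

Lemma bmeasB f g : bmeas f -> bmeas g -> bmeas (fun x => f x - g x).
Proof. by move=> bf bg; apply: bmeasD => //; exact: bmeasN. Qed.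

Lemma bmeas_norm f : bmeas f -> bmeas (fun x => `|f x|).
Proof.
move=> [mf [M fM]]; split; first exact: measurableT_comp.
by exists M => x; rewrite normr_id.
Qed.

Lemma bmeas_integrable mu f : bmeas f -> mu.-integrable setT (EFin \o f).
Proof.
move=> [mf [M fM]]; apply: measurable_bounded_integrable => //.
  by rewrite (le_lt_trans (probability_le1 _ _)) ?ltry.
exists M; split; first exact: num_real.
by move=> N MN x _; exact: le_trans (fM x) (ltW MN).
Qed.

Lemma EFin_Rintegral mu f : bmeas f ->
  (\int[mu]_x (f x)%:E)%E = (Rintegral mu setT f)%:E.
Proof.
by move=> bf; rewrite /Rintegral fineK// integrable_fin_num//; exact: bmeas_integrable.
Qed.

Lemma Rint_cst mu c : Rintegral mu setT (fun=> c) = c.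
Proof. by rewrite Rintegral_cst//; have /= -> := probability_setT mu; rewrite mulr1. Qed.

Lemma RintD mu f g : bmeas f -> bmeas g -> Rintegral mu setT (fun x => f x + g x) =
  Rintegral mu setT f + Rintegral mu setT g.
Proof. by move=> bf bg; rewrite RintegralD//; exact: bmeas_integrable. Qed.

Lemma RintZ mu c f : bmeas f ->
  Rintegral mu setT (fun x => c * f x) = c * Rintegral mu setT f.
Proof. by move=> bf; rewrite RintegralZl//; exact: bmeas_integrable. Qed.

Lemma Rint_le mu f g : bmeas f -> bmeas g -> (forall x, f x <= g x) ->
  Rintegral mu setT f <= Rintegral mu setT g.
Proof. by move=> bf bg fg; apply: le_Rintegral => //; exact: bmeas_integrable. Qed.

Lemma Rint_normle mu f : bmeas f ->
  `|Rintegral mu setT f| <= Rintegral mu setT (fun x => `|f x|).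
Proof. by move=> bf; apply: le_normr_Rintegral => //; exact: bmeas_integrable. Qed.

Lemma Rint_norm_bound mu f M : bmeas f -> (forall x, `|f x| <= M) ->
  `|Rintegral mu setT f| <= M.
Proof.
move=> bf fM; rewrite (le_trans (Rint_normle _ bf))// -(Rint_cst mu M).
by apply: Rint_le => //; [exact: bmeas_norm | exact: bmeas_cst].
Qed.

(** The variance of [|f|] under [mu], which is [int f^2 - m^2], is nonnegative. *)
Lemma sqr_Rint_norm_le mu f : bmeas f ->
  Rintegral mu setT (fun x => `|f x|) ^+ 2 <= Rintegral mu setT (fun x => f x ^+ 2).
Proof.
move=> bf; set m := Rintegral _ _ _.
have bn := bmeas_norm bf.
have b2 : bmeas (fun x => f x ^+ 2) by under eq_fun do rewrite expr2; exact: bmeasM.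
have : 0 <= Rintegral mu setT (fun x => (`|f x| - m) ^+ 2).
  by apply: Rintegral_ge0 => x _; exact: sqr_ge0.
have -> : (fun x => (`|f x| - m) ^+ 2) =
    (fun x => f x ^+ 2 + ((-2 * m) * `|f x| + m ^+ 2)).
  by apply/funext => x; rewrite -[f x ^+ 2]real_normK ?num_real//; ring.
have bZ := bmeasZ (-2 * m) bn; have bc := bmeas_cst (m ^+ 2).
rewrite RintD//; last exact: bmeasD.
rewrite RintD// Rint_cst RintZ// -/m.
by nra.
Qed.

End BoundedMeasurable.
Arguments bmeas_cst {d T R} c.

Section BoundedFubini.
Context d1 d2 (T1 : measurableType d1) (T2 : measurableType d2) (R : realType).
Variable F : T1 -> T2 -> R.
Hypothesis bF : bmeas (fun p : T1 * T2 => F p.1 p.2).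
Variables (mu : probability T1 R) (nu : probability T2 R).

Lemma bmeas_sec1 x : bmeas (F x).
Proof.
case: bF => mF [M FM]; split; last by exists M => y; exact: (FM (x, y)).
exact: (measurableT_comp mF (pair1_measurable x)).
Qed.

Lemma bmeas_Rint1 : bmeas (fun x => Rintegral nu setT (F x)).
Proof.
split; last first.
  case: (bF) => _ [M FM]; exists M => x; apply: Rint_norm_bound.
    exact: bmeas_sec1.
  by move=> y; exact: (FM (x, y)).
have mF := bF.1; apply/measurable_EFinP.
have -> : EFin \o (fun x => Rintegral nu setT (F x)) =
    fubini_F nu (fun p => (F p.1 p.2)%:E).
  apply/funext => x; rewrite /fubini_F /= EFin_Rintegral//; exact: bmeas_sec1.
apply: (@measurable_fubini_F _ _ _ _ _ mu nu).
exact: (@bmeas_integrable _ _ _ (mu \x nu)%E).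
Qed.

End BoundedFubini.
Arguments bmeas_Rint1 {d1 d2 T1 T2 R F}.

Lemma bmeas_swap d1 d2 (T1 : measurableType d1) (T2 : measurableType d2)
  (R : realType) (F : T1 -> T2 -> R) :
  bmeas (fun p : T1 * T2 => F p.1 p.2) -> bmeas (fun p : T2 * T1 => F p.2 p.1).
Proof.
move=> [mF [M FM]]; split; last by exists M => -[y x]; exact: (FM (x, y)).
by have := measurableT_comp mF (@measurable_swap _ _ T2 T1).
Qed.

Lemma Rint_Fubini d1 d2 (T1 : measurableType d1) (T2 : measurableType d2)
  (R : realType) (F : T1 -> T2 -> R)
  (mu : probability T1 R) (nu : probability T2 R) :
  bmeas (fun p : T1 * T2 => F p.1 p.2) ->
  Rintegral mu setT (fun x => Rintegral nu setT (F x)) =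
  Rintegral nu setT (fun y => Rintegral mu setT (F ^~ y)).
Proof.
move=> bF; have bF' := bmeas_swap bF.
apply: EFin_inj.
rewrite -(EFin_Rintegral mu (bmeas_Rint1 bF mu nu)).
rewrite -(EFin_Rintegral nu (bmeas_Rint1 bF' nu mu)).
transitivity (\int[mu]_x \int[nu]_y (F x y)%:E)%E.
  by apply: eq_integral => x _; rewrite EFin_Rintegral//; exact: (bmeas_sec1 bF).
transitivity (\int[nu]_y \int[mu]_x (F x y)%:E)%E; last first.
  apply: eq_integral => y _; rewrite EFin_Rintegral//.
  exact: (@bmeas_sec1 _ _ _ _ _ (fun y x => F x y) bF').
apply: (@Fubini _ _ T1 T2 R mu nu (fun p => (F p.1 p.2)%:E)).
exact: (@bmeas_integrable _ _ _ (mu \x nu)%E _ bF).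
Qed.

Lemma Rint_mixture d (T : measurableType d) (R : realType)
  (mu nu1 nu2 : probability T R) (e : R) (f : T -> R) : 0 <= e <= 1 ->
  (forall A, measurable A -> mu A = ((1 - e)%:E * nu1 A + e%:E * nu2 A)%E) ->
  bmeas f ->
  Rintegral mu setT f = (1 - e) * Rintegral nu1 setT f + e * Rintegral nu2 setT f.
Proof.
move=> /andP[e0 e1] hmu.
have pos g : bmeas g -> (forall x, 0 <= g x) -> Rintegral mu setT g =
    (1 - e) * Rintegral nu1 setT g + e * Rintegral nu2 setT g.
  move=> bg g0; apply: EFin_inj; rewrite EFinD !EFinM -!EFin_Rintegral//.
  have e1' : 0 <= 1 - e by rewrite subr_ge0.
  rewrite (eq_measure_integral
    (measure_add (mscale (NngNum e1') nu1) (mscale (NngNum e0) nu2))); last first.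
    move=> A mA _.
    rewrite -[RHS]/(measure_add (mscale (NngNum e1') nu1) (mscale (NngNum e0) nu2) A).
    by rewrite measure_addE; exact: hmu.
  have mg : measurable_fun setT (EFin \o g) by apply/measurable_EFinP; exact: bg.1.
  rewrite ge0_integral_measure_add//; last by move=> x _; rewrite lee_fin.
  by rewrite !ge0_integral_mscale// => x _; rewrite lee_fin.
move=> bf; have [_ [M fM]] := bf.
have bM := @bmeas_cst d T R M.
(* Adding the bound [M] makes [f] nonnegative; the weights [1 - e] and [e] sum to one, so [M]
   cancels afterwards. *)
have /pos : bmeas (fun x => f x + M) by exact: bmeasD.
rewrite !RintD// !Rint_cst => H.
have /H : forall x, 0 <= f x + M.
  by move=> x; rewrite -lerBlDr sub0r; have := fM x; rewrite ler_norml => /andP[].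
by move=> h; apply: (addIr M); rewrite h; ring.
Qed.

(** * Finite signed measures as functionals, with linearity and Fubini *)

Definition dens (R : realType) (mu : probability R R) (f : R -> R) : (R -> R) -> R :=
  fun h => Rintegral mu setT (fun x => f x * h x).

(* A finite signed measure is represented by its action [h |-> int h]; the functional is
   linear only on bounded measurable [h], since [Rintegral] is junk elsewhere. *)
Inductive signed (R : realType) : ((R -> R) -> R) -> Prop :=
| signed_pt x : signed (fun h => h x)
| signed_dens mu f : bmeas f -> signed (dens mu f)
| signed_lin c u v : signed u -> signed v -> signed (fun h => c * u h + v h).

Section Signed.
Context (R : realType).
Implicit Types (u v : (R -> R) -> R) (f g h : R -> R).

Lemma signedZ c u : signed u -> signed (fun h => c * u h).
Proof.
(* The linear constructor scales only its first argument, so [c u] is built as [(c - 1) u + u]. *)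
move=> su; have := signed_lin (c - 1) su su.
by congr signed; apply/funext => h; ring.
Qed.

Lemma signed0 : signed (fun _ : R -> R => 0).
Proof.
have := signedZ 0 (signed_pt (0 : R)).
by congr signed; apply/funext => h; rewrite mul0r.
Qed.

Lemma signedD u v : signed u -> signed v -> signed (fun h => u h + v h).
Proof.
move=> su sv; have := signed_lin 1 su sv.
by congr signed; apply/funext => h; rewrite mul1r.
Qed.

Lemma signedB u v : signed u -> signed v -> signed (fun h => u h - v h).
Proof.
move=> su sv; have := signed_lin (-1) sv su.
by congr signed; apply/funext => h; ring.
Qed.

Lemma signedE c u f g : signed u -> bmeas f -> bmeas g ->
  u (fun x => c * f x + g x) = c * u f + u g.
Proof.
move=> su bf bg; elim: su => [//|mu w bw|e u1 u2 _ -> _ ->]; last by ring.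
have bwf := bmeasM bw bf; have bwg := bmeasM bw bg.
rewrite /dens -RintZ// -RintD//; last exact: bmeasZ.
by congr Rintegral; apply/funext => x; ring.
Qed.

Lemma signedZE c u f : signed u -> bmeas f -> u (fun x => c * f x) = c * u f.
Proof.
move=> su bf; elim: su => [//|mu w bw|e u1 u2 _ -> _ ->]; last by ring.
have bwf := bmeasM bw bf; rewrite /dens -RintZ//.
by congr Rintegral; apply/funext => x; ring.
Qed.

Lemma signed_bmeas u (F : R -> R -> R) : signed u ->
  bmeas (fun p : R * R => F p.1 p.2) -> bmeas (fun x => u (F x)).
Proof.
move=> su bF; elim: su => [x|mu w bw|e u1 u2 _ b1 _ b2].
- exact: (@bmeas_sec1 _ _ _ _ _ (fun y x => F x y) (@bmeas_swap _ _ _ _ _ F bF)).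
- apply: (@bmeas_Rint1 _ _ R R R (fun x y => w y * F x y) _ mu mu).
  apply: bmeasM => //; split; last by case: bw => _ [M wM]; exists M => p.
  exact: measurableT_comp bw.1 measurable_snd.
- by apply: bmeasD => //; exact: bmeasZ.
Qed.

(** Linearity in [u] and in [v] reduces the exchange to generators. A point mass is immediate on
    either side, and two densities are Fubini. *)
Lemma signed_swap u v (F : R -> R -> R) : signed u -> signed v ->
  bmeas (fun p : R * R => F p.1 p.2) ->
  u (fun x => v (F x)) = v (fun y => u (F ^~ y)).
Proof.
move=> su sv bF; have bF' := @bmeas_swap _ _ _ _ _ F bF.
elim: su => [//|mu f bf|e u1 u2 s1 IH1 s2 IH2]; last first.
  rewrite IH1 IH2 (@signedE _ v)//.
    exact: (@signed_bmeas u1 (fun y x => F x y)).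
  exact: (@signed_bmeas u2 (fun y x => F x y)).
elim: sv => [//|nu g bg|e v1 v2 s1 IH1 s2 IH2].
  rewrite /dens.
  transitivity (Rintegral mu setT (fun x => Rintegral nu setT (fun y => f x * (g y * F x y)))).
    congr Rintegral; apply/funext => x; rewrite RintZ//.
    by apply: bmeasM => //; exact: (bmeas_sec1 bF).
  rewrite (@Rint_Fubini _ _ _ _ _ (fun x y => f x * (g y * F x y))).
    congr Rintegral; apply/funext => y; rewrite -RintZ.
      by congr Rintegral; apply/funext => x; ring.
    by apply: bmeasM => //; exact: (@bmeas_sec1 _ _ _ _ _ (fun y x => F x y)).
  apply: bmeasM; [|apply: bmeasM => //].
    split; last by case: bf => _ [M fM]; exists M => p.
    exact: measurableT_comp bf.1 measurable_fst.
  split; last by case: bg => _ [M gM]; exists M => p.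
  exact: measurableT_comp bg.1 measurable_snd.
have b1 : bmeas (fun x => v1 (F x)) by exact: signed_bmeas.
have b2 : bmeas (fun x => v2 (F x)) by exact: signed_bmeas.
by rewrite -IH1 -IH2 (signedE _ (signed_dens mu bf)).
Qed.

End Signed.

(** * The kernel form: positivity, Cauchy-Schwarz and the induced seminorm *)

(** This is the inner product in [H] of the embeddings of [u] and [v], expressed without
    constructing [H]. *)
Definition kform (R : realType) (k : R -> R -> R) (u v : (R -> R) -> R) : R :=
  u (fun x => v (k x)).

Definition knorm (R : realType) (k : R -> R -> R) (u : (R -> R) -> R) : R :=
  Num.sqrt (kform k u u).

Section KernelForm.
Context (R : realType) (k : R -> R -> R).
Hypothesis k_meas : measurable_fun setT (fun p : R * R => k p.1 p.2).
Hypotheses (k_pd : pd_kernel k) (k_bd : kernel_bounded_by_1 k).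
Implicit Types (u v : (R -> R) -> R) (f g h : R -> R).
Local Notation B := (kform k).

Lemma bmeas_kernel : bmeas (fun p : R * R => k p.1 p.2).
Proof. by split=> //; exists 1 => p; exact: k_bd. Qed.

Lemma bmeas_kernel_diag : bmeas (fun x => k x x).
Proof.
split; last by exists 1 => x; exact: k_bd.
by have := measurableT_comp k_meas
  (measurable_fun_pair (@measurable_id _ R setT) (@measurable_id _ R setT)).
Qed.

Lemma bmeas_potential u : signed u -> bmeas (fun x => u (k x)).
Proof. by move=> su; apply: signed_bmeas => //; exact: bmeas_kernel. Qed.

Lemma kform_sym u v : signed u -> signed v -> B u v = B v u.
Proof.
move=> su sv; rewrite /kform (signed_swap su sv bmeas_kernel).
by congr v; apply/funext => y; congr u; apply/funext => x; exact: k_pd.1.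
Qed.

Lemma kform_linl c u v w : B (fun h => c * u h + v h) w = c * B u w + B v w.
Proof. by []. Qed.

Lemma kform_linr c u v w : signed u -> signed v -> signed w ->
  B w (fun h => c * u h + v h) = c * B w u + B w v.
Proof. by move=> su sv sw; apply: signedE => //; exact: bmeas_potential. Qed.

Lemma kform_lin2 c u v : signed u -> signed v ->
  B (fun h => c * u h + v h) (fun h => c * u h + v h) =
  c ^+ 2 * B u u + 2 * c * B u v + B v v.
Proof.
move=> su sv; have suv := signed_lin c su sv.
by rewrite kform_linl !kform_linr// (kform_sym sv su); ring.
Qed.

(** Identities between functionals are available on bounded measurable functions only. The form
    evaluates its arguments at kernel sections and potentials, which are of this kind. *)
Lemma kform_ext u u' v v' : signed u -> signed v -> signed v' ->
  (forall h, bmeas h -> u h = u' h) -> (forall h, bmeas h -> v h = v' h) ->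
  B u v = B u' v'.
Proof.
move=> su sv sv' uu vv; rewrite /kform uu; last exact: bmeas_potential.
congr u'; apply/funext => x; apply: vv.
exact: (bmeas_sec1 bmeas_kernel).
Qed.

Lemma kform_discrete (s : seq (R * R)) :
  0 <= B (fun h => \sum_(p <- s) p.1 * h p.2) (fun h => \sum_(p <- s) p.1 * h p.2).
Proof.
rewrite /kform (big_tnth _ _ s).
have := k_pd.2 (size s) (fun i => (tnth (in_tuple s) i).1)
  (fun i => (tnth (in_tuple s) i).2).
congr (_ <= _); apply: eq_bigr => i _; rewrite (big_tnth _ _ s) mulr_sumr.
by apply: eq_bigr => j _; rewrite mulrA.
Qed.

(* Positivity is propagated through whole classes rather than single functionals:
   in the linear case of [psd_add_signed], the hypothesis on [u2] is applied to the
   class [C + R u1]. *)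
Definition pt_closed_psd (C : ((R -> R) -> R) -> Prop) : Prop :=
  (forall w, C w -> signed w /\ 0 <= B w w) /\
  (forall w c x, C w -> C (fun h => c * h x + w h)).

(* The right-hand side is [E (B W W)] for
   [W = w + c (f X_1 d_(X_1) + ... + f X_m d_(X_m))] with [X_i] i.i.d. of law [mu];
   the induction integrates one [X_i] at a time. *)
Lemma sampling_psd C mu f c m w : pt_closed_psd C -> bmeas f -> C w ->
  0 <= B w w + 2 * m%:R * c * B w (dens mu f)
       + m%:R * (m%:R - 1) * c ^+ 2 * B (dens mu f) (dens mu f)
       + m%:R * c ^+ 2 * Rintegral mu setT (fun x => f x ^+ 2 * k x x).
Proof.
move=> [Cpsd Cpt] bf Cw; set a := dens mu f; set K := Rintegral _ _ _.
have sa : signed a by exact: signed_dens.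
elim: m w Cw => [|m IH] w Cw.
  by rewrite !(mul0r, mulr0, addr0); exact: (Cpsd _ Cw).2.
have sw := (Cpsd _ Cw).1.
have bw := bmeas_potential sw; have ba := bmeas_potential sa.
(* [c0] is the induction hypothesis at [w]. Replacing [w] by [w + c f(x) d_x] adds
   [f(x) g(x) + c^2 f(x)^2 k(x,x)] to it, and integrating over [x] gives the case [m + 1]. *)
set c0 := B w w + 2 * m%:R * c * B w a + m%:R * (m%:R - 1) * c ^+ 2 * B a a
  + m%:R * c ^+ 2 * K.
pose g x := 2 * c * w (k x) + 2 * m%:R * c ^+ 2 * a (k x).
have H x : 0 <= c0 + (f x * g x + c ^+ 2 * (f x ^+ 2 * k x x)).
  have := IH _ (Cpt w (c * f x) x Cw).
  rewrite (kform_lin2 _ (signed_pt x) sw) kform_linl.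
  rewrite /g -[B _ a]/(a (k x)) -[B _ w]/(w (k x)) -[B (fun h => h x) _]/(k x x) /c0.
  by congr (0 <= _); ring.
have bK : bmeas (fun x => f x ^+ 2 * k x x).
  apply: bmeasM; last exact: bmeas_kernel_diag.
  by under eq_fun do rewrite expr2; exact: bmeasM.
have bg : bmeas g by apply: bmeasD; exact: bmeasZ.
have bfg := bmeasM bf bg; have bcK := bmeasZ (c ^+ 2) bK.
have : 0 <= Rintegral mu setT (fun x => c0 + (f x * g x + c ^+ 2 * (f x ^+ 2 * k x x))).
  by apply: Rintegral_ge0 => x _; exact: H.
rewrite RintD; [|exact: bmeas_cst|exact: bmeasD].
rewrite Rint_cst RintD// RintZ// -/K -[Rintegral mu setT (fun x => f x * g x)]/(a g).
rewrite /g (signedE _ sa)//; last exact: bmeasZ.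
have -> : a (fun x => 2 * m%:R * c ^+ 2 * a (k x)) = 2 * m%:R * c ^+ 2 * B a a.
  rewrite -[RHS]RintZ; last exact: bmeasM.
  by rewrite /dens; congr Rintegral; apply/funext => x; ring.
rewrite -[a (fun x => w (k x))]/(B a w) (kform_sym sa sw) /c0.
by congr (0 <= _); rewrite -natr1; ring.
Qed.

(** Approximation of [c f mu] by [m] sampled points of weight [c / m]: multiplied by [m], the
    sampling inequality reads [m X + Y >= 0], where [X] is the form at [c f mu + w] and [Y] does not
    depend on [m]. Letting [m] grow forces [X >= 0]. *)
Lemma psd_add_dens C mu f c w : pt_closed_psd C -> bmeas f -> C w ->
  0 <= B (fun h => c * dens mu f h + w h) (fun h => c * dens mu f h + w h).
Proof.
move=> CC bf Cw; set a := dens mu f.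
have sa : signed a by exact: signed_dens.
have sw := (CC.1 _ Cw).1.
set K := Rintegral mu setT (fun x => f x ^+ 2 * k x x).
rewrite kform_lin2// (kform_sym sa sw).
set X := _ + B w w; set Y := c ^+ 2 * (K - B a a).
suff H m : (0 < m)%N -> 0 <= m%:R * X + Y.
  rewrite leNgt; apply/negP => X0.
  have X0' : 0 < - X by rewrite oppr_gt0.
  pose n := (Num.truncn (`|Y| / - X)).+1.
  have := H n isT; apply/negP; rewrite -ltNge.
  have : `|Y| / - X < n%:R by exact: truncnS_gt.
  by rewrite ltr_pdivrMr// => h; have := ler_norm Y; lra.
move=> m0; have m0' : (m%:R : R) != 0 by rewrite pnatr_eq0 -lt0n.
have := @sampling_psd C mu f (c / m%:R) m w CC bf Cw.
rewrite -/K -/a => /(mulr_ge0 (ler0n R m)).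
congr (0 <= _).
by rewrite /X /Y; field.
Qed.

Lemma psd_add_signed C u c w : pt_closed_psd C -> signed u -> C w ->
  0 <= B (fun h => c * u h + w h) (fun h => c * u h + w h).
Proof.
move=> + su; elim: su C c w => [x|mu f bf|e u1 u2 s1 IH1 s2 IH2] C c w CC Cw.
- exact: (CC.1 _ (CC.2 _ _ _ Cw)).2.
- exact: psd_add_dens CC bf Cw.
pose D v := exists t w', C w' /\ v = (fun h => t * u1 h + w' h).
have DD : pt_closed_psd D.
  split=> [_ [t [w' [Cw' ->]]]|_ e' x [t [w' [Cw' ->]]]].
    split; last exact: IH1 CC Cw'.
    by apply: signed_lin => //; exact: (CC.1 _ Cw').1.
  exists t, (fun h => e' * h x + w' h); split; first exact: CC.2.
  by apply/funext => h; ring.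
have Dw : D (fun h => c * e * u1 h + w h) by exists (c * e), w.
have := IH2 D c _ DD Dw.
by congr (0 <= B _ _); apply/funext => h; ring.
Qed.

(** Finite combinations of point masses form a class to which [psd_add_signed] applies, by positive
    definiteness of [k]; then [u] is added to its zero element. *)
Lemma kform_ge0 u : signed u -> 0 <= B u u.
Proof.
move=> su.
pose C v := signed v /\ exists s : seq (R * R),
  v = (fun h : R -> R => \sum_(p <- s) p.1 * h p.2).
have CC : pt_closed_psd C.
  split=> [v [sv [s vE]]|v c x [sv [s vE]]].
    by split=> //; rewrite vE; exact: kform_discrete.
  split; first by apply: signed_lin => //; exact: signed_pt.
  by exists ((c, x) :: s); apply/funext => h; rewrite big_cons vE.
have C0 : C (fun=> 0).
  split; first exact: signed0.
  by exists [::]; apply/funext => h; rewrite big_nil.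
have := psd_add_signed 1 CC su C0.
by congr (0 <= B _ _); apply/funext => h; ring.
Qed.

Lemma kform_CauchySchwarz u v : signed u -> signed v ->
  B u v <= knorm k u * knorm k v.
Proof.
move=> su sv; rewrite /knorm.
have qu := kform_ge0 su; have qv := kform_ge0 sv.
have H t : 0 <= t ^+ 2 * B u u + 2 * t * B u v + B v v.
  by rewrite -kform_lin2//; apply: kform_ge0; exact: signed_lin.
rewrite -sqrtrM//; apply: (le_trans (ler_norm _)); rewrite -sqrtr_sqr.
rewrite ler_sqrt ?mulr_ge0//.
have [u0|u0] := eqVneq (B u u) 0.
  have [->|Bn0] := eqVneq (B u v) 0; first by rewrite expr0n mulr_ge0.
  (* If [B u u = 0], the polynomial is affine in [t], and this [t] gives it the value [-1]. *)
  have := H (- (B v v + 1) / (2 * B u v)); rewrite u0.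
  have -> : 2 * (- (B v v + 1) / (2 * B u v)) * B u v = - (B v v + 1) by field.
  by lra.
have u0' : 0 < B u u by rewrite lt_def u0.
(* The minimiser of the quadratic polynomial in [t]. *)
have := H (- B u v / B u u).
have -> : (- B u v / B u u) ^+ 2 * B u u + 2 * (- B u v / B u u) * B u v + B v v =
   B v v - B u v ^+ 2 / B u u by field.
by rewrite subr_ge0 ler_pdivrMr// mulrC.
Qed.

Lemma knorm_ge0 u : 0 <= knorm k u.
Proof. exact: sqrtr_ge0. Qed.

Lemma sqr_knorm u : signed u -> knorm k u ^+ 2 = B u u.
Proof. by move=> su; rewrite sqr_sqrtr// kform_ge0. Qed.

Lemma knormD u v : signed u -> signed v ->
  knorm k (fun h => u h + v h) <= knorm k u + knorm k v.
Proof.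
move=> su sv; rewrite -(@ler_pXn2r _ 2)// ?nnegrE ?addr_ge0 ?knorm_ge0//.
rewrite sqr_knorm; last exact: signedD.
have -> : (fun h => u h + v h) = (fun h => 1 * u h + v h).
  by apply/funext => h; rewrite mul1r.
rewrite kform_lin2//; have := kform_CauchySchwarz su sv.
have := sqr_knorm su; have := sqr_knorm sv; rewrite sqrrD => -> ->.
by rewrite expr1n; lra.
Qed.

Lemma knormZ c u : signed u -> knorm k (fun h => c * u h) = `|c| * knorm k u.
Proof.
move=> su; rewrite /knorm -sqrtr_sqr -sqrtrM ?sqr_ge0//; congr Num.sqrt.
by rewrite /kform (signedZE _ su) ?expr2 ?mulrA//; exact: bmeas_potential.
Qed.

(** Since [|k| <= 1], the potential of [f mu] is at most [m] in absolute value; integrating it once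
    more against [f mu] gives [m^2]. *)
Lemma knorm_dens mu f : bmeas f ->
  knorm k (dens mu f) <= Rintegral mu setT (fun x => `|f x|).
Proof.
move=> bf; set m := Rintegral _ _ _; have bn := bmeas_norm bf.
have sf := signed_dens mu bf.
have m0 : 0 <= m by apply: Rintegral_ge0 => x _.
rewrite -(@ler_pXn2r _ 2)// ?nnegrE ?knorm_ge0// sqr_knorm//.
have bd g M : bmeas g -> (forall x, `|g x| <= M) -> `|dens mu f g| <= m * M.
  move=> bg gM; rewrite (le_trans (Rint_normle _ (bmeasM bf bg)))//.
  rewrite mulrC -RintZ//; apply: Rint_le => //.
  - by apply: bmeas_norm; exact: bmeasM.
  - exact: bmeasZ.
  - by move=> x; rewrite normrM mulrC ler_wpM2r.
rewrite expr2 (le_trans (ler_norm _))//; apply: (bd); first exact: bmeas_potential.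
move=> x; rewrite -[leRHS]mulr1; apply: bd; last exact: k_bd.
exact: (bmeas_sec1 bmeas_kernel).
Qed.

End KernelForm.

(** * Means under the binomial law *)

(** The mean of [h(N)] for [N] binomial([n], [p]), by conditioning on one trial at a time, which
    matches the recursion of [sample_expect]. *)
Fixpoint binomial_mean (R : realType) (p : R) (n : nat) (h : nat -> R) : R :=
  if n is n'.+1 then
    p * binomial_mean p n' (fun m => h m.+1) + (1 - p) * binomial_mean p n' h
  else h 0%N.

Section BinomialMean.
Context (R : realType) (p : R).
Hypothesis p01 : 0 <= p <= 1.

Lemma binomial_mean_lin n c (f g : nat -> R) :
  binomial_mean p n (fun m => f m + c * g m) =
  binomial_mean p n f + c * binomial_mean p n g.
Proof.
elim: n f g => [//|n IH] f g /=.
by rewrite (IH (fun m => f m.+1) (fun m => g m.+1)) IH; ring.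
Qed.

Lemma binomial_mean_le n (f g : nat -> R) : (forall m, f m <= g m) ->
  binomial_mean p n f <= binomial_mean p n g.
Proof.
have /andP[p0 p1] := p01.
elim: n f g => [|n IH] f g fg /=; first exact: fg.
by apply: lerD; apply: ler_wpM2l; rewrite ?subr_ge0//; apply: IH => m.
Qed.

Lemma binomial_mean_cst n (c : R) : binomial_mean p n (fun=> c) = c.
Proof. by elim: n => [//|n IH] /=; rewrite IH; ring. Qed.

(** [N] is a sum of [n + 1] exchangeable indicators; given that one of them equals [1], the others
    contribute a binomial([n], [p]) count. *)
Lemma binomial_mean_size_bias n (h : nat -> R) :
  binomial_mean p n.+1 (fun m => m%:R * h m) =
  n.+1%:R * p * binomial_mean p n (fun m => h m.+1).
Proof.
elim: n h => [|n IH] h; first by rewrite /=; ring.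
set lhs := LHS.
have -> : lhs = p * binomial_mean p n.+1 (fun m => m%:R * h m.+1 + 1 * h m.+1)
    + (1 - p) * binomial_mean p n.+1 (fun m => m%:R * h m).
  rewrite /lhs; congr (p * binomial_mean p n.+1 _ + _).
  by apply/funext => m; rewrite -natr1; ring.
by rewrite binomial_mean_lin !IH -[n.+2%:R]natr1 /=; ring.
Qed.

(** Size biasing with [h(m) = 1/m] turns the left side, times [(n + 1) p], into the mean of
    [m * (1/m)], which is [0] at [m = 0] and [1] elsewhere. *)
Lemma binomial_mean_inv_le n : 0 < p ->
  binomial_mean p n (fun m => m.+1%:R^-1) <= (n.+1%:R * p)^-1.
Proof.
move=> p0; have np : 0 < n.+1%:R * p by rewrite mulr_gt0// ltr0n.
rewrite -[leRHS]mul1r ler_pdivlMr// mulrC.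
rewrite -(binomial_mean_size_bias n (fun m => m%:R^-1)).
rewrite -[leRHS](binomial_mean_cst n.+1); apply: binomial_mean_le => -[|m].
  by rewrite mul0r.
by rewrite mulfV// pnatr_eq0.
Qed.

End BinomialMean.

(** * Monotonicity of the sample expectation without measurability *)

(** The integral of a nonnegative function is a supremum over the simple functions below it, and a
    larger function admits more of them. *)
Lemma ge0_le_integral_nonmeas d (T : measurableType d) (R : realType)
  (mu : {measure set T -> \bar R}) (f g : T -> \bar R) :
  (forall x, 0 <= f x)%E -> (forall x, f x <= g x)%E ->
  (\int[mu]_x f x <= \int[mu]_x g x)%E.
Proof.
move=> f0 fg; have g0 x : (0 <= g x)%E by exact: le_trans (f0 x) (fg x).
rewrite !ge0_integralTE//; apply: le_ereal_sup => _ [h hf <-].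
by exists h => // x; exact: le_trans (hf x) (fg x).
Qed.

Section SampleExpect.
Context (R : realType) (PX : probability R R) (pi : R -> R).
Hypothesis pi01 : forall x, 0 <= pi x <= 1.

Lemma sample_expect_ge0 n g : (forall s, size s = n -> (0 <= g s)%E) ->
  (0 <= sample_expect PX pi n g)%E.
Proof.
elim: n g => [|n IH] g g0 /=; first exact: g0.
apply: integral_ge0 => x _; have /andP[? ?] := pi01 x.
by apply: adde_ge0; apply: mule_ge0; rewrite ?lee_fin ?subr_ge0//;
  apply: IH => s sn; apply: g0; rewrite /= sn.
Qed.

(** The comparison is restricted to samples of size [n] because the minimiser property is given for
    these. *)
Lemma sample_expect_le n g g' : (forall s, size s = n -> (0 <= g s)%E) ->
  (forall s, size s = n -> (g s <= g' s)%E) ->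
  (sample_expect PX pi n g <= sample_expect PX pi n g')%E.
Proof.
elim: n g g' => [|n IH] g g' g0 gg' /=; first exact: gg'.
have cons0 x b s : size s = n -> (0 <= g ((x, b) :: s))%E.
  by move=> sn; apply: g0; rewrite /= sn.
apply: ge0_le_integral_nonmeas => x; have /andP[? ?] := pi01 x.
  by apply: adde_ge0; apply: mule_ge0; rewrite ?lee_fin ?subr_ge0//;
    apply: sample_expect_ge0 => s; exact: cons0.
by apply: leeD; apply: lee_wpmul2l; rewrite ?lee_fin ?subr_ge0//;
  apply: IH => s sn; [exact: cons0|apply: gg'; rewrite /= sn
                     |exact: cons0|apply: gg'; rewrite /= sn].
Qed.

End SampleExpect.

(** * The observed sample, its law and its mean squared fluctuation *)

Definition nobs (R : realType) (s : seq (R * bool)) : nat :=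
  count (fun q => ~~ q.2) s.

Definition obs_sum (R : realType) (s : seq (R * bool)) : (R -> R) -> R :=
  fun h => \sum_(q <- s | ~~ q.2) h q.1.

Lemma signed_obs_sum (R : realType) (s : seq (R * bool)) : signed (obs_sum s).
Proof.
rewrite /obs_sum; elim: s => [|[x b] s IH].
  have := @signed0 R; congr signed; apply/funext => h; by rewrite big_nil.
case: b.
  by move: IH; congr signed; apply/funext => h; rewrite big_cons.
have := signedD (signed_pt x) IH; congr signed; apply/funext => h.
by rewrite big_cons.
Qed.

Section Observed.
Context (R : realType) (k : R -> R -> R).
Hypothesis k_meas : measurable_fun setT (fun p : R * R => k p.1 p.2).
Hypotheses (k_pd : pd_kernel k) (k_bd : kernel_bounded_by_1 k).
Context (PX : probability R R) (pi : R -> R) (pi_meas : measurable_fun setT pi).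
Hypothesis pi01 : forall x, 0 <= pi x <= 1.
Let p := Rintegral PX setT pi.
Hypothesis p_gt0 : 0 < p.
Local Notation B := (kform k).

(** The law of [X] given [M = 0], which has density [pi / p] with respect to [PX]. *)
Definition obs_law : (R -> R) -> R := dens PX (fun x => p^-1 * pi x).

Lemma bmeas_pi : bmeas pi.
Proof.
split=> //; exists 1 => x; have /andP[? ?] := pi01 x.
by rewrite ger0_norm.
Qed.

Lemma signed_obs_law : signed obs_law.
Proof. by apply: signed_dens; apply: bmeasZ; exact: bmeas_pi. Qed.

Lemma Rint_pi f : bmeas f -> Rintegral PX setT (fun x => pi x * f x) = p * obs_law f.
Proof.
move=> bf; rewrite /obs_law /dens -RintZ.
  by congr Rintegral; apply/funext => x; rewrite !mulrA divff ?mul1r// gt_eqF.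
by apply: bmeasM => //; apply: bmeasZ; exact: bmeas_pi.
Qed.

Lemma obs_law_cst c : obs_law (fun=> c) = c.
Proof.
have p0 : p != 0 by rewrite gt_eqF.
apply: (mulfI p0); rewrite -Rint_pi; last exact: bmeas_cst.
under eq_Rintegral do rewrite mulrC.
by rewrite RintZ 1?mulrC//; exact: bmeas_pi.
Qed.

Lemma Rint_pi_le1 : p <= 1.
Proof.
rewrite /p -[leRHS](Rint_cst PX); apply: Rint_le; first exact: bmeas_pi.
  exact: bmeas_cst.
by move=> x; have /andP[] := pi01 x.
Qed.

(** The sum of [d_(X_i) - P_obs] over the observed points, started at [v] so that an induction over
    the sample can accumulate into [v]. *)
Definition centered (v : (R -> R) -> R) (s : seq (R * bool)) : (R -> R) -> R :=
  fun h => v h + (obs_sum s h - (nobs s)%:R * obs_law h).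

(** The variance of the feature map under [obs_law], that is, the mean of [|d_X - P_obs|^2]. *)
Definition obs_var : R := obs_law (fun x => k x x) - B obs_law obs_law.

Lemma obs_var_le1 : obs_var <= 1.
Proof.
have q0 := kform_ge0 k_meas k_pd k_bd signed_obs_law.
suff : obs_law (fun x => k x x) <= 1 by rewrite /obs_var; lra.
have bK := bmeas_kernel_diag k_meas k_bd.
rewrite -[leRHS]obs_law_cst; have b1 := bmeasZ p^-1 bmeas_pi.
apply: Rint_le; [exact: bmeasM|by apply: bmeasM => //; exact: bmeas_cst|move=> x].
apply: ler_wpM2l; last exact: le_trans (ler_norm _) (k_bd _ _).
apply: mulr_ge0; first by rewrite invr_ge0; exact: ltW.
by have /andP[] := pi01 x.
Qed.

(** For [X] of law [obs_law], [d_X - P_obs] has mean zero, so the cross term with [v] vanishes on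
    average. *)
Lemma obs_law_kform v : signed v ->
  let vx x := fun h => 1 * h x + (- 1 * obs_law h + v h) in
  bmeas (fun x => B (vx x) (vx x)) /\
  obs_law (fun x => B (vx x) (vx x)) = B v v + obs_var.
Proof.
move=> sv vx; pose w := fun h => - 1 * obs_law h + v h.
have so := signed_obs_law.
have sw : signed w by exact: signed_lin.
have bw := bmeas_potential k_meas k_bd sw.
have bK := bmeas_kernel_diag k_meas k_bd.
have qE : (fun x => B (vx x) (vx x)) = (fun x => 2 * w (k x) + (1 * k x x + B w w)).
  apply/funext => x; rewrite (kform_lin2 k_meas k_pd k_bd _ (signed_pt x) sw).
  by rewrite -[B _ _ in X in X + _ + _]/(k x x) -[B (fun h => h x) w]/(w (k x)); ring.
have bc := bmeas_cst (T := R) (B w w).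
rewrite qE; split.
  by apply: bmeasD; [exact: bmeasZ|apply: bmeasD => //; exact: bmeasZ].
rewrite (signedE _ so)//; last by apply: bmeasD => //; exact: bmeasZ.
rewrite (signedE _ so)// obs_law_cst -[obs_law (fun x => w (k x))]/(B obs_law w).
rewrite (kform_lin2 k_meas k_pd k_bd _ so sv) (kform_linr k_meas k_bd _ so sv so).
by rewrite /obs_var; ring.
Qed.

(** Given that [m] points are observed, they are independent of law [obs_law], and each adds
    [obs_var] to the mean square. In the induction, an observed pair moves [v] to [vx x] and shifts
    [A] and [phi]; a missing pair changes nothing. *)
Lemma sample_expect_centered n (A phi : nat -> R) v : signed v ->
  sample_expect PX pi n (fun s =>
    (A (nobs s) + phi (nobs s) * B (centered v s) (centered v s))%:E) =
  (binomial_mean p n (fun m => A m + phi m * (B v v + m%:R * obs_var)))%:E.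
Proof.
elim: n A phi v => [|n IH] A phi v sv.
  rewrite /= (_ : centered v [::] = v) ?mul0r ?addr0//.
  by apply/funext => h; rewrite /centered /obs_sum big_nil /= mul0r subrr addr0.
have [bq obsq] := obs_law_kform sv.
set vx := fun x => fun h => 1 * h x + (- 1 * obs_law h + v h) in bq obsq.
have svx x : signed (vx x).
  by apply: signed_lin; [exact: signed_pt|apply: signed_lin => //; exact: signed_obs_law].
(* The value claimed by the induction hypothesis as a function of [a = B v v]. It is affine in [a],
   so averaging over the new point only requires the mean of [B (vx x) (vx x)]. *)
pose F A phi a := binomial_mean p n (fun m => A m + phi m * (a + m%:R * obs_var)).
have FE A' phi' a : F A' phi' a = F A' phi' 0 + a * binomial_mean p n phi'.
  rewrite /F -binomial_mean_lin; congr binomial_mean; apply/funext => m; ring.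
have obsE x s : centered v ((x, false) :: s) = centered (vx x) s.
  apply/funext => h; rewrite /centered /obs_sum big_cons /= /vx -natr1; ring.
have misE x s : centered v ((x, true) :: s) = centered v s.
  by apply/funext => h; rewrite /centered /obs_sum big_cons.
pose A1 m := A m.+1; pose phi1 m := phi m.+1.
set c1 := F A1 phi1 0; set c2 := binomial_mean p n phi1; set c3 := F A phi (B v v).
transitivity (\int[PX]_x (c3 + pi x * (c2 * B (vx x) (vx x) + (c1 - c3)))%:E)%E.
  rewrite /=; apply: eq_integral => x _.
  rewrite (_ : sample_expect PX pi n _ = (F A1 phi1 (B (vx x) (vx x)))%:E); last first.
    rewrite /F -(IH A1 phi1 _ (svx x)); congr sample_expect.
    by apply/funext => s; rewrite obsE.
  rewrite (_ : sample_expect PX pi n _ = c3%:E); last first.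
    rewrite /c3 /F -(IH A phi _ sv); congr sample_expect.
    by apply/funext => s; rewrite misE.
  by rewrite FE -!EFinM -EFinD -/c1 -/c2; congr EFin; ring.
have bi : bmeas (fun x => c2 * B (vx x) (vx x) + (c1 - c3)).
  by apply: bmeasD; [exact: bmeasZ|exact: bmeas_cst].
have bpi := bmeas_pi.
rewrite EFin_Rintegral; last by apply: bmeasD; [exact: bmeas_cst|exact: bmeasM].
rewrite RintD ?Rint_cst; [|exact: bmeas_cst|exact: bmeasM].
rewrite Rint_pi// (signedE _ signed_obs_law)//; last exact: bmeas_cst.
rewrite obs_law_cst obsq; congr EFin.
transitivity (p * F A1 phi1 (B v v + obs_var) + (1 - p) * c3).
  by rewrite FE -/c1 -/c2; ring.
rewrite /=; congr (p * _ + _); rewrite /F; congr binomial_mean.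
by apply/funext => m; rewrite /A1 /phi1 -natr1; ring.
Qed.

End Observed.

(** * The MMD as a seminorm of a difference, and the minimiser *)

Section MMDForm.
Context (R : realType) (k : R -> R -> R).
Hypothesis k_meas : measurable_fun setT (fun p : R * R => k p.1 p.2).
Hypotheses (k_pd : pd_kernel k) (k_bd : kernel_bounded_by_1 k).
Local Notation B := (kform k).
Local Notation law mu := (dens mu (fun=> 1)).

Lemma signed_law (mu : probability R R) : signed (law mu).
Proof. by apply: signed_dens; exact: bmeas_cst. Qed.

Lemma lawE (mu : probability R R) h : law mu h = Rintegral mu setT h.
Proof. by rewrite /dens; congr Rintegral; apply/funext => x; rewrite mul1r. Qed.

Lemma kformB c u v : signed u -> signed v ->
  B (fun h => c * u h - v h) (fun h => c * u h - v h) =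
  c ^+ 2 * B u u - 2 * c * B v u + B v v.
Proof.
move=> su sv; have scu := signedZ c su.
have -> : (fun h => c * u h - v h) = (fun h => - 1 * v h + (c * u h)).
  by apply/funext => h; ring.
rewrite (kform_lin2 k_meas k_pd k_bd _ sv scu).
have BZr w : signed w -> B w (fun h => c * u h) = c * B w u.
  by move=> sw; rewrite /kform (signedZE _ sw)//; exact: bmeas_potential.
rewrite BZr// -[B (fun h => c * u h) _]/(c * B u (fun h => c * u h)) BZr//.
by ring.
Qed.

Lemma kint_law (mu nu : probability R R) : kint k mu nu = B (law mu) (law nu).
Proof.
have bk := bmeas_kernel k_meas k_bd.
rewrite /kform lawE /kint.
rewrite /Rintegral; congr fine; apply: eq_integral => x _.
by rewrite EFin_Rintegral ?lawE//; exact: (bmeas_sec1 bk).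
Qed.

Lemma MMD_knorm (mu nu : probability R R) :
  MMD k mu nu = knorm k (fun h => 1 * law mu h - law nu h).
Proof.
rewrite /MMD /MMD2 /knorm; congr Num.sqrt.
have smu := signed_law mu; have snu := signed_law nu.
rewrite (kformB _ smu snu) !kint_law (kform_sym k_meas k_pd k_bd snu smu).
by ring.
Qed.

Lemma MMD2_dirac (mu : probability R R) x :
  MMD2 k mu (\d_x : {measure set R -> \bar R}) =
  B (law mu) (law mu) - 2 * law mu (k x) + k x x.
Proof.
rewrite /MMD2 kint_law.
have -> : kint k mu (\d_x : {measure set R -> \bar R}) = law mu (k x).
  rewrite lawE /kint /Rintegral; congr fine; apply: eq_integral => y _.
  rewrite integral_dirac ?diracT ?mul1e ?(k_pd.1 y)//.
  by apply/measurable_EFinP; exact: (bmeas_sec1 (bmeas_kernel k_meas k_bd) y).1.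
congr (_ + _); rewrite /kint.
rewrite (eq_integral (fun y => (k x y)%:E)); last first.
  move=> y _; rewrite integral_dirac ?diracT ?mul1e ?(k_pd.1 y)//.
  by apply/measurable_EFinP; exact: (bmeas_sec1 (bmeas_kernel k_meas k_bd) y).1.
rewrite integral_dirac ?diracT ?mul1e//.
by apply/measurable_EFinP; exact: (bmeas_sec1 (bmeas_kernel k_meas k_bd) x).1.
Qed.

Lemma knorm_law_le1 (mu : probability R R) : knorm k (law mu) <= 1.
Proof.
have := knorm_dens k_meas k_pd k_bd mu (bmeas_cst 1).
by rewrite normr1 Rint_cst.
Qed.

Lemma MMD_le2 (mu nu : probability R R) : MMD k mu nu <= 2.
Proof.
rewrite MMD_knorm; have smu := signed_law mu; have snu := signed_law nu.
have -> : (fun h => 1 * law mu h - law nu h) = (fun h => law mu h + - 1 * law nu h).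
  by apply/funext => h; ring.
have := knormD k_meas k_pd k_bd smu (signedZ (- 1) snu).
rewrite (knormZ k_meas k_bd _ snu) normrN1 mul1r => /le_trans; apply.
by have := knorm_law_le1 mu; have := knorm_law_le1 nu; lra.
Qed.

Section Minimiser.
Context (Theta : Type) (P : Theta -> probability R R).
Context (n : nat) (s : seq (R * bool)) (th th0 : Theta).
Hypothesis n_gt0 : (0 < n)%N.
Hypothesis hmin : mmd_criterion k P n s th <= mmd_criterion k P n s th0.

Lemma mmd_criterionE t : mmd_criterion k P n s t =
  n%:R^-1 * ((nobs s)%:R * B (law (P t)) (law (P t))
    - 2 * B (obs_sum s) (law (P t)) + obs_sum s (fun x => k x x)).
Proof.
rewrite /mmd_criterion; congr (_ * _).
under eq_bigr do rewrite MMD2_dirac.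
rewrite big_split/= big_split/= sumrN -mulr_sumr -/(obs_sum s (fun x => k x x)).
by rewrite big_const_seq iter_addr_0 [(nobs s)%:R * _]mulr_natl.
Qed.

(** The squared seminorm equals [n N] times the criterion plus a term independent of the parameter,
    where [N = nobs s]. *)
Lemma knorm_minimiser :
  knorm k (fun h => (nobs s)%:R * law (P th) h - obs_sum s h) <=
  knorm k (fun h => (nobs s)%:R * law (P th0) h - obs_sum s h).
Proof.
have sS := signed_obs_sum s.
rewrite /knorm ler_wsqrtr//.
rewrite (kformB _ (signed_law (P th)) sS) (kformB _ (signed_law (P th0)) sS).
move: hmin; rewrite !mmd_criterionE ler_pM2l ?invr_gt0 ?ltr0n// => h.
have N0 := ler0n R (nobs s).
have := ler_wpM2l N0 h; lra.
Qed.

End Minimiser.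
End MMDForm.

(** * Error for a fixed sample, and bias of the observed law *)

Section PointwiseBound.
Context (R : realType) (k : R -> R -> R).
Hypothesis k_meas : measurable_fun setT (fun p : R * R => k p.1 p.2).
Hypotheses (k_pd : pd_kernel k) (k_bd : kernel_bounded_by_1 k).
Context (PX : probability R R) (pi : R -> R) (pi_meas : measurable_fun setT pi).
Hypothesis pi01 : forall x, 0 <= pi x <= 1.
Hypothesis p_gt0 : 0 < Rintegral PX setT pi.
Context (Theta : Type) (P : Theta -> probability R R).
Local Notation B := (kform k).
Local Notation law mu := (dens mu (fun=> 1)).
Local Notation obs := (obs_law PX pi).
Local Notation p := (Rintegral PX setT pi).

(** [N (P_th - P_th0)] is a difference of two terms [N P_t - S], both of seminorm at most [r], the
    one at [th0]. In turn [S - N P_th0 = (S - N P_obs) + N (P_obs - P_th0)] bounds [r]. *)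
Lemma MMD_minimiser_le n s th th0 : (0 < n)%N -> (0 < nobs s)%N ->
  mmd_criterion k P n s th <= mmd_criterion k P n s th0 ->
  MMD k (P th) (P th0) <=
  2 * knorm k (centered PX pi (fun=> 0) s) / (nobs s)%:R
  + 2 * knorm k (fun h => 1 * obs h - law (P th0) h).
Proof.
move=> n0 N0 hmin; set N := (nobs s)%:R : R.
have N0' : 0 < N by rewrite ltr0n.
have so := signed_obs_law PX pi_meas pi01.
have sS := signed_obs_sum s.
have s1 := signed_law (P th); have s0 := signed_law (P th0).
have r0 := knorm_minimiser k_meas k_pd k_bd n0 hmin.
have sd t : signed (fun h => N * law (P t) h - obs_sum s h).
  by apply: signedB => //; apply: signedZ; exact: signed_law.
set r := knorm k (fun h => N * law (P th0) h - obs_sum s h) in r0.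
have so0 : signed (fun h => 1 * obs h - law (P th0) h).
  by apply: signedB => //; exact: signedZ.
have sc : signed (centered PX pi (fun=> 0) s).
  apply: signedD; first exact: signed0.
  by apply: signedB => //; exact: signedZ.
have r_le : r <= knorm k (centered PX pi (fun=> 0) s)
    + N * knorm k (fun h => 1 * obs h - law (P th0) h).
  have -> : r = knorm k (fun h => - 1 * (N * law (P th0) h - obs_sum s h)).
    by rewrite (knormZ k_meas k_bd _ (sd th0)) normrN1 mul1r.
  have := knormD k_meas k_pd k_bd sc (signedZ N so0).
  rewrite (knormZ k_meas k_bd _ so0) (ger0_norm (ltW N0')).
  congr (knorm k _ <= _); apply/funext => h; rewrite /centered -/N; ring.
have D_le : N * MMD k (P th) (P th0) <= r + r.
  rewrite (MMD_knorm k_meas k_pd k_bd).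
  have sD : signed (fun h => 1 * law (P th) h - law (P th0) h).
    by apply: signedB => //; exact: signedZ.
  rewrite -[X in X * _](ger0_norm (ltW N0')) -(knormZ k_meas k_bd _ sD).
  have := knormD k_meas k_pd k_bd (sd th) (signedZ (- 1) (sd th0)).
  rewrite (knormZ k_meas k_bd _ (sd th0)) normrN1 mul1r -/r => H.
  apply: le_trans (le_trans H _); last by rewrite lerD2r.
  by rewrite le_eqVlt; apply/orP; left; apply/eqP; congr knorm;
    apply/funext => h; ring.
rewrite -(ler_pM2l N0') (le_trans D_le)//.
rewrite mulrDr mulrCA mulfV ?gt_eqF// mulr1.
by lra.
Qed.

Lemma obs_law_bias (P0 QX : probability R R) (eps : R) :
  0 <= eps < 1 ->
  (forall A, measurable A -> PX A = ((1 - eps)%:E * P0 A + eps%:E * QX A)%E) ->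
  let p0 := Rintegral P0 setT pi in 0 < p0 ->
  (1 - eps) * p0 <= p /\
  knorm k (fun h => 1 * obs h - law P0 h) <=
  Num.sqrt (Rintegral P0 setT (fun x => (pi x - p0) ^+ 2)) / p0
  + 2 * eps / (p0 * (1 - eps)).
Proof.
move=> /andP[e0 e1] hmix p0 p0_gt0.
have e01 : 0 <= eps <= 1 by rewrite e0 ltW.
have bpi := bmeas_pi pi_meas pi01.
have mixE f : bmeas f -> Rintegral PX setT f =
    (1 - eps) * Rintegral P0 setT f + eps * Rintegral QX setT f.
  exact: Rint_mixture.
set q := Rintegral QX setT pi.
have pE : p = (1 - eps) * p0 + eps * q by exact: mixE.
have q0 : 0 <= q by apply: Rintegral_ge0 => x _; have /andP[] := pi01 x.
have eq0 : 0 <= eps * q by exact: mulr_ge0.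
have p_ge : (1 - eps) * p0 <= p by rewrite pE lerDl.
split=> //.
have pn0 : p != 0 by rewrite gt_eqF.
have p0n0 : p0 != 0 by rewrite gt_eqF.
have bc : bmeas (fun x => pi x - p0) by apply: bmeasB => //; exact: bmeas_cst.
pose u1 := dens P0 (fun x => pi x - p0).
pose u2 := dens P0 pi. pose u3 := dens QX pi.
have s1 : signed u1 by exact: signed_dens.
have s2 : signed u2 by exact: signed_dens.
have s3 : signed u3 by exact: signed_dens.
have so := signed_obs_law PX pi_meas pi01.
have sP := signed_law P0.
(* Decomposition of [P_obs - P0] obtained from [p = (1 - eps) p0 + eps q]; it isolates the variation
   of [pi] under [P0] from two contamination terms. *)
pose w h := p0^-1 * u1 h + (- (eps * q / (p * p0)) * u2 h + eps / p * u3 h).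
have sw2 := signedZ (- (eps * q / (p * p0))) s2.
have sw3 := signedZ (eps / p) s3.
have sw1 := signedZ p0^-1 s1.
have sw23 := signedD sw2 sw3.
have sw : signed w by exact: signedD.
have -> : knorm k (fun h => 1 * obs h - law P0 h) = knorm k w.
  have E h : bmeas h -> 1 * obs h - law P0 h = w h.
    move=> bh; rewrite mul1r.
    have -> : obs h = p^-1 * Rintegral PX setT (fun x => pi x * h x).
      by rewrite (Rint_pi pi_meas pi01 p_gt0 bh) mulrA mulVf// mul1r.
    have bpih := bmeasM bpi bh.
    rewrite [Rintegral PX setT (fun x => pi x * h x)]mixE//.
    rewrite -[Rintegral P0 setT (fun x => pi x * h x)]/(u2 h).
    rewrite -[Rintegral QX setT (fun x => pi x * h x)]/(u3 h).
    have u1E : u1 h = u2 h - p0 * law P0 h.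
      rewrite lawE /u1 /u2 /dens -mulNr -RintZ// -RintD//; last exact: bmeasZ.
      by congr Rintegral; apply/funext => x; ring.
    have p'n0 : (1 - eps) * p0 + eps * q != 0.
      by move: pn0; rewrite pE.
    by rewrite /w u1E pE; field; rewrite p0n0 p'n0.
  have so0 : signed (fun h => 1 * obs h - law P0 h).
    exact: (signedB (signedZ 1 so) sP).
  by rewrite /knorm; congr Num.sqrt; apply: kform_ext.
have pinn x : `|pi x| = pi x by rewrite ger0_norm//; have /andP[] := pi01 x.
have n1 : knorm k u1 <= Num.sqrt (Rintegral P0 setT (fun x => (pi x - p0) ^+ 2)).
  apply: (le_trans (knorm_dens k_meas k_pd k_bd P0 bc)).
  rewrite -[leLHS]ger0_norm; last by apply: Rintegral_ge0 => x _.
  by rewrite -sqrtr_sqr ler_wsqrtr// sqr_Rint_norm_le.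
have n2 : knorm k u2 <= p0.
  apply: (le_trans (knorm_dens k_meas k_pd k_bd P0 bpi)).
  by under eq_Rintegral do rewrite pinn.
have n3 : knorm k u3 <= q.
  apply: (le_trans (knorm_dens k_meas k_pd k_bd QX bpi)).
  by under eq_Rintegral do rewrite pinn.
have q1 : q <= 1.
  rewrite /q -[leRHS](Rint_cst QX); apply: Rint_le; [exact: bpi|exact: bmeas_cst|].
  by move=> x; have /andP[] := pi01 x.
apply: (le_trans (knormD k_meas k_pd k_bd sw1 sw23)); apply: lerD.
  rewrite (knormZ k_meas k_bd _ s1) ger0_norm ?invr_ge0 ?(ltW p0_gt0)// mulrC.
  by rewrite ler_wpM2r// invr_ge0 ltW.
apply: (le_trans (knormD k_meas k_pd k_bd sw2 sw3)).
rewrite (knormZ k_meas k_bd _ s2) (knormZ k_meas k_bd _ s3) normrN.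
have p_gt0' := p_gt0.
rewrite !ger0_norm ?divr_ge0 ?mulr_ge0 ?(ltW p_gt0) ?(ltW p0_gt0)//.
have ep : eps / p <= eps / (p0 * (1 - eps)).
  have e1' : 0 < 1 - eps by rewrite subr_gt0.
  by rewrite ler_wpM2l// lef_pV2 ?posrE ?mulr_gt0// mulrC.
(* Each contamination term is at most [eps q / p], with [q <= 1]. *)
apply: (@le_trans _ _ (eps / p + eps / p)); last first.
  by rewrite -mulrA mulr_natl mulr2n lerD.
have epn : 0 <= eps / p by rewrite divr_ge0// ltW.
apply: lerD.
  apply: (@le_trans _ _ (eps * q / (p * p0) * p0)).
    by rewrite ler_wpM2l// divr_ge0// mulr_ge0// ltW.
  have -> : eps * q / (p * p0) * p0 = eps / p * q by field; rewrite p0n0 pn0.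
  by rewrite -[leRHS]mulr1 ler_wpM2l.
rewrite -[leRHS]mulr1 ler_wpM2l//; exact: le_trans n3 q1.
Qed.

End PointwiseBound.

(** * Domination of the integrand, its expectation, and the constants *)

Theorem theorem9 (R : realType) (Theta : Type) (P : Theta -> probability R R)
  (k : R -> R -> R)
  (k_meas : measurable_fun setT (fun p : R * R => k p.1 p.2))
  (k_pd : pd_kernel k) (k_bd : kernel_bounded_by_1 k)
  (k_char : characteristic k)
  (PX QX : probability R R) (eps : R) (theta_star : Theta)
  (heps : 0 <= eps < 1)
  (hmix : forall A, measurable A ->
     PX A = ((1 - eps)%:E * P theta_star A + eps%:E * QX A)%E)
  (pi : R -> R) (pi_meas : measurable_fun setT pi)
  (pi01 : forall x, 0 <= pi x <= 1)
  (pi_star : R)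
  (hpi_star : pi_star = Rintegral (P theta_star) setT pi)
  (hpi_pos : 0 < pi_star)
  (n : nat) (hn : (0 < n)%N)
  (theta_n : seq (R * bool) -> Theta)
  (hmin : forall s, size s = n -> forall theta,
     mmd_criterion k P n s (theta_n s) <= mmd_criterion k P n s theta) :
  (sample_expect PX pi n
     (fun s => (MMD k (P (theta_n s)) (P theta_star))%:E)
   <= (4 * eps + 8 * eps / (pi_star * (1 - eps))
       + 2 * Num.sqrt (Rintegral (P theta_star) setT (fun x => (pi x - pi_star) ^+ 2))
           / pi_star
       + 2 * Num.sqrt 2 / Num.sqrt (n%:R * pi_star * (1 - eps)))%:E)%E.
Proof.
have [eps0 eps1] := andP heps.
have e1 : 0 < 1 - eps by rewrite subr_gt0.
have pi0_gt0 : 0 < Rintegral (P theta_star) setT pi by rewrite -hpi_star.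
set p := Rintegral PX setT pi.
have p_gt0 : 0 < p.
  rewrite /p (@Rint_mixture _ _ _ PX (P theta_star) QX eps) ?eps0 ?(ltW eps1)//; last first.
    exact: bmeas_pi.
  rewrite ltr_wpDr ?mulr_gt0// mulr_ge0//.
  by apply: Rintegral_ge0 => x _; have /andP[] := pi01 x.
have [] := obs_law_bias k_meas k_pd k_bd pi_meas pi01 p_gt0 heps hmix pi0_gt0.
rewrite -hpi_star -/p; set b := _ / _ + _; move=> p_ge bias.
set c := 2 * Num.sqrt 2 / Num.sqrt (n%:R * pi_star * (1 - eps)).
have n0 : 0 < n%:R :> R by rewrite ltr0n.
have d_gt0 : 0 < n%:R * pi_star * (1 - eps) by rewrite !mulr_gt0.
have c_gt0 : 0 < c by rewrite /c divr_gt0 ?mulr_gt0 ?sqrtr_gt0.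
have c2 : c ^+ 2 = 8 / (n%:R * pi_star * (1 - eps)).
  by rewrite /c expr_div_n exprMn !sqr_sqrtr ?ltW//; congr (_ / _); ring.
have p01 : 0 <= p <= 1 by rewrite ltW//= (Rint_pi_le1 PX pi_meas pi01).
(* Linearised bound in the shape that [sample_expect_centered] integrates. At [m = 0], [phi]
   vanishes because the inverse of zero is zero, and the indicator raises [A] to at least
   [c / 2 + 2 / c >= 2], which covers [D <= 2]. *)
pose A (m : nat) : R := 2 * b + c / 2 + 2 / c * (m == 0%N)%:R.
pose phi (m : nat) : R := 2 / c * (m%:R ^- 2).
have dom s : size s = n ->
    ((MMD k (P (theta_n s)) (P theta_star))%:E <=
     (A (nobs s) + phi (nobs s) *
        kform k (centered PX pi (fun=> 0) s) (centered PX pi (fun=> 0) s))%:E)%E.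
  move=> sn; rewrite lee_fin /A /phi.
  have b0 : 0 <= b by apply: le_trans bias; exact: knorm_ge0.
  have [N0|N0] := posnP (nobs s).
    have := MMD_le2 k_meas k_pd k_bd (P (theta_n s)) (P theta_star).
    rewrite N0 expr0n invr0 mulr0 mul0r addr0 mulr1.
    have : 2 <= c / 2 + 2 / c.
      rewrite -subr_ge0; have -> : c / 2 + 2 / c - 2 = (c - 2) ^+ 2 / (2 * c).
        by field; rewrite gt_eqF.
      by rewrite divr_ge0 ?sqr_ge0// mulr_ge0// ltW.
    by lra.
  have := MMD_minimiser_le k_meas k_pd k_bd PX pi_meas pi01 hn N0 (hmin s sn theta_star).
  have sc : signed (centered PX pi (fun=> 0) s).
    apply: signedD; first exact: signed0.
    apply: signedB; first exact: signed_obs_sum.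
    by apply: signedZ; exact: signed_obs_law.
  rewrite -(sqr_knorm k_meas k_pd k_bd sc).
  set r := knorm k (centered _ _ _ _); set N := (nobs s)%:R.
  have Nn0 : N != 0 :> R by rewrite pnatr_eq0 -lt0n.
  rewrite mulr0 addr0.
  (* AM-GM: [2 r / N <= c / 2 + 2 r^2 / (c N^2)] *)
  have : 2 * r / N <= c / 2 + 2 / c * N ^- 2 * r ^+ 2.
    rewrite -subr_ge0.
    have -> : c / 2 + 2 / c * N ^- 2 * r ^+ 2 - 2 * r / N = (c - 2 * r / N) ^+ 2 / (2 * c).
      by field; rewrite Nn0 gt_eqF.
    by rewrite divr_ge0 ?sqr_ge0// mulr_ge0// ltW.
  by move: bias; lra.
apply: le_trans (sample_expect_le PX pi01 _ dom) _.
  by move=> s _; rewrite lee_fin; exact: sqrtr_ge0.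
rewrite (sample_expect_centered k_meas k_pd k_bd pi_meas pi01 p_gt0)//; last exact: signed0.
rewrite lee_fin -/p.
have k00 : kform k (fun=> 0) (fun=> 0) = 0 by [].
rewrite k00.
set sg := obs_var k PX pi.
have sg1 : sg <= 1 by exact: obs_var_le1.
(* The stated bound exceeds [2 b + c] by [4 eps + 4 eps / (pi_star (1 - eps))]. *)
apply: (@le_trans _ _ (2 * b + c)); last first.
  have V0 := sqrtr_ge0 (Rintegral (P theta_star) setT (fun x => (pi x - pi_star) ^+ 2)).
  rewrite -/c lerD2r /b mulrDr mulrA.
  have -> : 8 * eps / (pi_star * (1 - eps)) = 2 * (2 * eps / (pi_star * (1 - eps)))
      + 2 * (2 * eps / (pi_star * (1 - eps))) by ring.
  have : 0 <= 2 * eps / (pi_star * (1 - eps)).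
    by rewrite divr_ge0 ?mulr_ge0 ?(ltW e1) ?(ltW hpi_pos).
  by lra.
(* For [m >= 1], [phi(m) m sg <= (2 / c) / m <= (4 / c) / (m + 1)] since [m + 1 <= 2 m]; at [m = 0]
   the indicator term [2 / c] is below [4 / c]. *)
apply: (@le_trans _ _ (binomial_mean p n (fun m => (2 * b + c / 2) + 4 / c * m.+1%:R^-1))).
  apply: binomial_mean_le => // m; rewrite /A /phi add0r -addrA lerD2l.
  case: m => [|m].
    by rewrite eqxx mul0r !mulr0 addr0 mulr1 invr1 mulr1 ler_pM2r ?invr_gt0// ler_nat.
  rewrite mulr0 add0r.
  have m1 : 0 < m.+1%:R :> R by rewrite ltr0n.
  have m2 : 0 < m.+2%:R :> R by rewrite ltr0n.
  have -> : 2 / c / m.+1%:R ^+ 2 * (m.+1%:R * sg) = 2 / c * (m.+1%:R^-1 * sg).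
    by field; rewrite !gt_eqF.
  have -> : 4 / c / m.+2%:R = 2 / c * (2 / m.+2%:R) by field; rewrite !gt_eqF.
  have c20 : 0 < 2 / c by exact: divr_gt0.
  rewrite ler_pM2l//.
  apply: (@le_trans _ _ (m.+1%:R^-1)).
    by rewrite -[leRHS]mulr1 ler_pM2l ?invr_gt0.
  rewrite -[leLHS]mul1r ler_pdivrMr// mulrAC ler_pdivlMr// mul1r -natrM ler_nat.
  by rewrite mul2n -addnn !addSn addnS ltnS ltnS leq_addr.
rewrite (binomial_mean_lin p n (4 / c) (fun=> 2 * b + c / 2)
  (fun m => m.+1%:R^-1)).
rewrite binomial_mean_cst; have H := binomial_mean_inv_le p01 n p_gt0.
have c4 : 0 <= 4 / c by rewrite divr_ge0// ltW.
(* The value of [c] balances the two halves: [c^2 / 2 = 4 / (n pi_star (1 - eps))], and [(n + 1) p]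
   is at least [n pi_star (1 - eps)]. *)
suff Hc : 4 / c * (n.+1%:R * p)^-1 <= c / 2.
  have -> : 2 * b + c = 2 * b + c / 2 + c / 2 by lra.
  by rewrite lerD2l (le_trans (ler_wpM2l c4 H)).
have cp : 0 < c * (n.+1%:R * p).
  by apply: mulr_gt0 => //; apply: mulr_gt0 => //; rewrite ltr0n.
rewrite -mulrA -invfM ler_pdivrMr//.
have -> : c / 2 * (c * (n.+1%:R * p)) = c ^+ 2 / 2 * (n.+1%:R * p) by ring.
rewrite c2.
have np : n%:R * pi_star * (1 - eps) <= n.+1%:R * p.
  rewrite -mulrA (mulrC pi_star); apply: ler_pM => //.
  - by rewrite mulr_ge0 ?ltW.
  - by rewrite ler_nat.
have -> : 8 / (n%:R * pi_star * (1 - eps)) / 2 * (n.+1%:R * p) =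
   4 * ((n.+1%:R * p) / (n%:R * pi_star * (1 - eps))).
  by field; rewrite !gt_eqF.
by rewrite ler_peMr// ler_pdivlMr// mul1r.
Qed.
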